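(* Let $(X,\Vert\cdot\Vert_X)$ be an asymmetrically normed space with conjugate space $\bar X$, let $f:X\to\overline{\mathbb{R}}$ be a proper function, $x\in X$ and $\phi\in\bar X^*$. Set $g=f-\phi$ and consider the following statements: (i) $f$ is lower semicontinuous at $x$ (with respect to the topology of $X$), and $f^*:\bar X^*\to\overline{\mathbb{R}}$ is right Fréchet differentiable at $\phi$ with $Df^*(\phi)=x$ (i.e. $Df^*(\phi)$ is the evaluation map $\psi\mapsto\psi(x)$ on $\bar X^*$). Moreover, there exists a sequence $(y_n)_{n\in\mathbb{N}}$ in $X$ such that $\lim_{n\to\infty}g(y_n)=\inf g(X)$ and $\lim_{n\to\infty}y_n=x$ in $X$, i.e. $\lim_{n\to\infty}\Vert y_n-x\Vert_X=0$. (ii) $g(x)=\inf g(X)$, and for every sequence $(y_n)_{n\in\mathbb{N}}$ in $X$: if $\lim_{n\to\infty}g(y_n)=g(x)$, then $\lim_{n\to\infty}y_n=x$ in $\bar X$, i.e. $\lim_{n\to\infty}\Vert x-y_n\Vert_X=0$. (iii) $f(x)\in\mathbb{R}$ and $f^{**}(x)=f(x)$. Then (i) $\implies$ (ii) $\implies$ (iii). Moreover, if $f$ is convex, then (i) $\iff$ (ii).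
   Context: An asymmetric norm on a real vector space $X$ is a function $p=\Vert\cdot\Vert_X:X\to\mathbb{R}_{\ge0}$ such that for all $r\ge0$ and $x,y\in X$: $x=0\iff p(x)=p(-x)=0$; $p(rx)=rp(x)$; $p(x+y)\le p(x)+p(y)$. The pair $(X,p)$ is an asymmetrically normed space. Its topology has at each $x\in X$ the neighbourhood basis $B_r(x)=\{y\in X: p(y-x)<r\}$, $r>0$. The conjugate space is $\bar X=(X,\bar p)$ with $\bar p(x)=p(-x)$, again an asymmetrically normed space. The dual cone $X^*$ is the set of all linear $\phi:X\to\mathbb{R}$ that are upper semicontinuous on $X$; equivalently, those for which there is $C\ge0$ with $\phi(x)\le C\Vert x\Vert_X$ for all $x\in X$. It is closed under sums and multiplication by non-negative scalars and carries the functional $\Vert\phi\Vert_{X^*}=\sup_{x\in B_1(0)}\phi(x)$, which makes it a normed cone. $\bar X^*$ denotes the dual cone of $\bar X$; one has $\bar X^*=-X^*$. The topology of $\bar X^*$ has at each $\phi\in\bar X^*$ the neighbourhood basis $\{\phi+\psi:\psi\in\bar X^*,\ \Vert\psi\Vert_{\bar X^*}<r\}$, $r>0$. $\overline{\mathbb{R}}=\{-\infty\}\cup\mathbb{R}\cup\{\infty\}$. A function $f:X\to\overline{\mathbb{R}}$ is convex if its epigraph $\{(x,t)\in X\times\mathbb{R}:f(x)\le t\}$ is convex, and proper if it never takes the value $-\infty$ and is not identically $\infty$. For $f:X\to\overline{\mathbb{R}}$, the convex conjugate $f^*:\bar X^*\to\overline{\mathbb{R}}$ is $f^*(\phi)=\sup_{y\in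 X}[\phi(y)-f(y)]$. For $k:\bar X^*\to\overline{\mathbb{R}}$, the conjugate $k^*:X\to\overline{\mathbb{R}}$ is $k^*(x)=\sup_{\phi\in\bar X^*}[\phi(x)-k(\phi)]$. Thus $f^{**}=(f^* )^*:X\to\overline{\mathbb{R}}$. A function $F:Y\to\overline{\mathbb{R}}$ on a normed cone $Y$ (here $Y=\bar X^*$) is right Gâteaux differentiable at $u\in Y$ if $F(u)\in\mathbb{R}$ and there is a continuous map $L:Y\to\mathbb{R}$, linear with respect to linear combinations with non-negative scalars, such that $\lim_{t\searrow0}\frac1t[F(u+tv)-F(u)-tL(v)]=0$ for all $v\in Y$; then $DF(u):=L$. $F$ is right Fréchet differentiable at $u$ if it is right Gâteaux differentiable at $u$ and $$\lim_{t\searrow0}\ \sup_{v\in Y,\ \Vert v\Vert=t}\frac1t\bigl|F(u+v)-F(u)-DF(u)(v)\bigr|=0,$$ where the supremum of the empty set is taken to be $0$. A point $x\in X$ is identified with its evaluation map $\psi\mapsto\psi(x)$ on $\bar X^*$, which is continuous. *)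

(* Defs.v *)
From HB Require Import structures.
From mathcomp Require Import all_boot all_order all_algebra.
From mathcomp Require Import all_classical all_reals all_analysis.

Set Implicit Arguments.
Unset Strict Implicit.
Unset Printing Implicit Defensive.

Import Order.TTheory GRing.Theory Num.Theory.
Import numFieldNormedType.Exports.

Local Open Scope classical_set_scope.
Local Open Scope ring_scope.

Record asym_norm (R : realType) (X : lmodType R) := AsymNorm {
  asym_norm_fun :> X -> R ;
  asym_norm_ge0 : forall x, 0 <= asym_norm_fun x ;
  asym_norm_eq0 : forall x,
    x = 0 <-> asym_norm_fun x = 0 /\ asym_norm_fun (- x) = 0 ;
  asym_normZ : forall (r : R) x, 0 <= r ->
    asym_norm_fun (r *: x) = r * asym_norm_fun x ;
  asym_normD : forall x y,
    asym_norm_fun (x + y) <= asym_norm_fun x + asym_norm_fun y }.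

Section conjugate_space.
Context (R : realType) (X : lmodType R) (p : asym_norm X).

Let q (x : X) : R := p (- x).

Let q_ge0 x : 0 <= q x. Proof. exact: asym_norm_ge0. Qed.

Let q_eq0 x : x = 0 <-> q x = 0 /\ q (- x) = 0.
Proof. by rewrite /q opprK (asym_norm_eq0 p x) and_comm. Qed.

Let qZ (r : R) x : 0 <= r -> q (r *: x) = r * q x.
Proof. by move=> r0; rewrite /q -scalerN asym_normZ. Qed.

Let qD x y : q (x + y) <= q x + q y.
Proof. by rewrite /q opprD asym_normD. Qed.

Definition conj_norm : asym_norm X := AsymNorm q_ge0 q_eq0 qZ qD.

End conjugate_space.

Section asymmetric_topology.
Context (R : realType) (X : lmodType R) (p : asym_norm X).

Definition asym_ball (x : X) (r : R) : set X := [set y | p (y - x) < r].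

Definition asym_nbhs (x : X) : set_system X :=
  filter_from [set r : R | 0 < r] (asym_ball x).

Definition lsc_at (f : X -> \bar R) (x : X) :=
  forall a : R, (a%:E < f x)%E -> asym_nbhs x [set y | (a%:E < f y)%E].

Definition usc_at (f : X -> \bar R) (x : X) :=
  forall a : R, (f x < a%:E)%E -> asym_nbhs x [set y | (f y < a%:E)%E].

Definition dual_cone : set (X -> R^o) :=
  [set phi | scalar phi /\ forall x, usc_at (EFin \o phi) x].

(* The supremum is finite on [dual_cone]. *)
Definition dual_norm (phi : X -> R^o) : \bar R :=
  ereal_sup [set (phi x)%:E | x in asym_ball 0 1].

Lemma dual_coneP (phi : X -> R^o) : dual_cone phi <->
  scalar phi /\ exists2 C : R, 0 <= C & forall x, phi x <= C * p x.
Proof.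
have phi0 : scalar phi -> phi 0 = 0.
  by move=> /(_ (-1) 0 0) /eqP; rewrite scaleN1r oppr0 addr0 mulN1r addNr => /eqP.
have phiZ : scalar phi -> forall a x, phi (a *: x) = a * phi x.
  by move=> lp a x; rewrite -[a *: x]addr0 lp phi0// addr0.
split=> -[lp H]; split=> //.
- have [|r /= r0 hr] := H 0 1; first by rewrite /= phi0// lte_fin ltr01.
  have hr' x : p x < r -> phi x < 1.
    by move=> pxr; rewrite -lte_fin; apply: hr; rewrite /asym_ball/= subr0.
  exists (2 / r) => [|x]; first by rewrite divr_ge0// ltW.
  have := asym_norm_ge0 p x; rewrite le_eqVlt => /orP[/eqP p0|p0].
    rewrite -p0 mulr0 leNgt; apply/negP => px.
    have := hr' ((phi x)^-1 *: x).
    rewrite asym_normZ ?invr_ge0 ?ltW// -p0 mulr0 => /(_ r0).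
    by rewrite phiZ// mulVf ?gt_eqF// ltxx.
  have s0 : 0 < r / 2 / p x by rewrite !divr_gt0.
  have := hr' ((r / 2 / p x) *: x).
  rewrite asym_normZ ?(ltW s0)// phiZ// divfK ?gt_eqF//.
  rewrite ltr_pdivrMr// mulr_natr mulr2n ltrDl => /(_ r0).
  by rewrite -ltr_pdivlMl// mulr1 !invf_div [X in _ < X]mulrC => /ltW.
- case: H => C C0 hC x a; rewrite /= lte_fin -subr_gt0 => xa.
  have C1 : 0 < C + 1 by rewrite ltr_wpDl.
  exists ((a - phi x) / (C + 1)); first by rewrite /= divr_gt0.
  move=> y; rewrite /asym_ball/= => yx; rewrite lte_fin.
  have -> : phi y = phi x + phi (y - x).
    by rewrite addrC -[y in LHS](subrK x) -[y - x in LHS]scale1r lp mul1r.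
  rewrite -ltrBrDl (le_lt_trans (hC _))//.
  rewrite (@le_lt_trans _ _ ((C + 1) * p (y - x)))//.
    by rewrite ler_wpM2r ?asym_norm_ge0// lerDl.
  by rewrite mulrC -ltr_pdivlMr.
Qed.

End asymmetric_topology.

Section convexity.
Context (R : realType) (X : lmodType R).
Local Open Scope ereal_scope.

Definition proper_fun (f : X -> \bar R) :=
  (forall x, f x != -oo) /\ exists x, f x != +oo.

Definition epigraph (f : X -> \bar R) : set (X * R^o) :=
  [set xt | f xt.1 <= xt.2%:E].

Definition convex_efun (f : X -> \bar R) := convex_set (epigraph f).

Definition conv_conj (f : X -> \bar R) (phi : X -> R^o) : \bar R :=
  ereal_sup [set (phi y)%:E - f y | y in [set: X]].

(* Functions on the dual cone of the conjugate space are represented by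
   functions on all of X -> R, of which only the values on that cone matter. *)
Definition conv_conj_dual (p : asym_norm X) (k : (X -> R^o) -> \bar R) (x : X) :
    \bar R :=
  ereal_sup [set (phi x)%:E - k phi | phi in dual_cone (conj_norm p)].

Definition conv_biconj (p : asym_norm X) (f : X -> \bar R) : X -> \bar R :=
  conv_conj_dual p (conv_conj f).

End convexity.

(* Differentiability on a cone Y in a real vector space V, with functional N;
   F and L only matter on Y. *)
Section cone_differentiability.
Context (R : realType) (V : lmodType R) (Y : set V) (N : V -> \bar R).

Definition cone_nbhs (u : V) : set_system V :=
  filter_from [set r : R | 0 < r]
    (fun r => [set u + v | v in [set v | Y v /\ (N v < r%:E)%E]]).

Definition cone_continuous (L : V -> R) :=
  forall u, Y u -> L @ cone_nbhs u --> L u.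

Definition cone_linear (L : V -> R) :=
  forall (a b : R) u v, 0 <= a -> 0 <= b -> Y u -> Y v ->
    L (a *: u + b *: v) = a * L u + b * L v.

Definition is_right_gateaux_derivative (F : V -> \bar R) (u : V) (L : V -> R) :=
  [/\ F u \is a fin_num, cone_continuous L, cone_linear L &
      forall v, Y v ->
        ((t^-1)%R%:E * (F (u + t *: v)%R - F u - (t * L v)%R%:E))%E
          @[t --> (0 : R)^'+] --> 0%E].

Definition ereal_sup0 (A : set (\bar R)) : \bar R :=
  if A == set0 then 0%E else ereal_sup A.

Definition is_right_frechet_derivative (F : V -> \bar R) (u : V) (L : V -> R) :=
  is_right_gateaux_derivative F u L /\
  ereal_sup0 [set ((t^-1)%R%:E * `|F (u + v)%R - F u - (L v)%:E|)%E |
                v in [set v | Y v /\ N v = t%:E]]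
    @[t --> (0 : R)^'+] --> 0%E.

End cone_differentiability.

(* Main.v *)
Require Import Defs.
From HB Require Import structures.
From mathcomp Require Import all_boot all_order all_algebra.
From mathcomp Require Import all_classical all_reals all_analysis.
From mathcomp Require Import lra.

Set Implicit Arguments.
Unset Strict Implicit.
Unset Printing Implicit Defensive.

Import Order.TTheory GRing.Theory Num.Theory.
Import numFieldNormedType.Exports.

Local Open Scope classical_set_scope.
Local Open Scope ring_scope.

(** Write [q] for the conjugate norm, so that [q (y - x) = p (x - y)], and
    [m] for the infimum of [g = f - phi]; then [f^* phi = - m].  Statement (ii)
    says that [x] minimises [g] and that the minimisation problem is well posed
    for [p (x - _)]: points where [g] is close to [m] have small [p (x - y)].

    (i) => (ii).  If [y] nearly minimises [g], then for every [psi] in the dual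
    cone of the conjugate space [f^* (phi + psi) - f^* phi - psi x] is at least
    [psi (y - x)] up to a small error.  By Hahn-Banach, some [psi] of dual norm
    exactly [t] has [psi (y - x) = t * p (x - y)], while Frechet
    differentiability bounds the left side by [e * t]; hence [p (x - y)] is
    small ([frechet_well_posed]).  The sequence given by (i) therefore
    converges to [x] for both [p] and [q]; so [phi] is continuous along it, and
    lower semicontinuity of [f] yields [g x = m] ([lsc_lim_le]).

    (ii) => (iii).  The supremum defining [f^** x] is attained at [phi]
    ([min_biconj]).

    (ii) => (i) for convex [f].  Well-posedness gives a gap between [m] and the
    values of [g] on a small sphere around [x], and convexity turns the gap into
    linear growth outside the ball ([convex_well_posed_growth]).  Small [psi]
    cannot beat this growth, so the remainder of [f^*] at [phi] is at most
    [e * t] uniformly in [psi] of norm [t] ([conj_remainder]).  Lower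
    semicontinuity of [f] at [x] comes from the supporting functional [phi], and
    the constant sequence [x] is minimising.

    Hahn-Banach is obtained from minimal sublinear functionals. *)

(** * Sublinear functionals and Hahn-Banach *)

(** Homogeneity is an inequality: it passes to infima directly, and the
    converse inequality follows by rescaling. *)
Definition sublinear (R : realType) (X : lmodType R) (s : X -> R) :=
  (forall r y, 0 <= r -> s (r *: y) <= r * s y) /\
  (forall y z, s (y + z) <= s y + s z).

Section sublinear_functionals.
Context (R : realType) (X : lmodType R).
Implicit Types (s q : X -> R) (v y z : X).

Lemma sublinear0 s : sublinear s -> s 0 = 0.
Proof.
move=> [sZ sD]; have := sZ 0 0 (lexx 0); have := sD 0 0.
rewrite scale0r mul0r addr0; lra.
Qed.

Lemma sublinearN s y : sublinear s -> - s (- y) <= s y.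
Proof.
move=> ss; have := ss.2 y (- y); rewrite subrr sublinear0//; lra.
Qed.

Lemma sublinearZ s r y : sublinear s -> 0 <= r -> s (r *: y) = r * s y.
Proof.
move=> ss; rewrite le_eqVlt => /orP[/eqP<-|r0].
  by rewrite scale0r mul0r sublinear0.
apply/eqP; rewrite eq_le ss.1 ?(ltW r0)//=.
have r'0 : 0 <= r^-1 by rewrite invr_ge0 ltW.
rewrite -ler_pdivlMl// (le_trans _ (ss.1 r^-1 (r *: y) r'0))//.
by rewrite scalerA mulVf ?scale1r// gt_eqF.
Qed.

(** The members of the family need not be sublinear one by one; the two
    conditions only ask for inequalities up to a change of index. *)
Lemma inf_family_sublinear (I : Type) (i0 : I) (S : I -> X -> R) (b : X -> R) :
    (forall i y, b y <= S i y) ->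
    (forall i r y, 0 <= r -> exists j, S j (r *: y) <= r * S i y) ->
    (forall i j y z, exists k, S k (y + z) <= S i y + S j z) ->
  let s y := inf (range (S^~ y)) in
  sublinear s /\ forall i y, s y <= S i y.
Proof.
move=> Sb SZ SD s.
have sle i y : s y <= S i y.
  apply: (@ge_inf _ (range (S^~ y))); last by exists i.
  by exists (b y) => _ [j _ <-].
have les y c : (forall i, c <= S i y) -> c <= s y.
  by move=> cS; apply: lb_le_inf => [|_ [i _ <-]//]; exists (S i0 y), i0.
split=> //; split=> [r y|y z].
- rewrite le_eqVlt => /orP[/eqP<-|r0].
    have [j] := SZ i0 0 y (lexx 0).
    by rewrite !mul0r => /(le_trans (sle _ _)).
  rewrite -ler_pdivrMl//; apply: les => i; rewrite ler_pdivrMl//.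
  by have [j] := SZ i r y (ltW r0); apply: le_trans.
- rewrite -lerBlDr; apply: (les) => i; rewrite lerBlDr -lerBlDl.
  apply: les => j; rewrite lerBlDl.
  by have [k] := SD i j y z; apply: le_trans.
Qed.

(** Sliding lowers [s] just enough to make it at most [- s v] at [- v], as for
    a linear functional, while preserving sublinearity; so a minimal sublinear
    functional coincides with all its slides. *)
Definition slide s v y : R :=
  inf (range (fun t : {nonneg R} => s (y + t%:num *: v) - t%:num * s v)).

Lemma slideP s v : sublinear s ->
  [/\ sublinear (slide s v), forall y, slide s v y <= s y &
      slide s v (- v) <= - s v].
Proof.
move=> ss.
have := @inf_family_sublinear {nonneg R} 0%:nng
  (fun t y => s (y + t%:num *: v) - t%:num * s v) (fun y => - s (- y)).
case=> [t y|t r y r0|t t' y z|sl le].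
- have := ss.2 (y + t%:num *: v) (- y).
  by rewrite addrAC subrr add0r sublinearZ//; lra.
- exists ((NngNum r0)%:num * t%:num)%:nng.
  by rewrite /= -scalerA -scalerDr mulrBr mulrA lerD2r; exact: ss.1.
- exists (t%:num + t'%:num)%:nng; rewrite /= scalerDl addrACA mulrDl.
  have := ss.2 (y + t%:num *: v) (z + t'%:num *: v); lra.
split; first exact: sl.
- move=> y; apply: le_trans (le 0%:nng y) _.
  by rewrite /= scale0r mul0r addr0 subr0.
- apply: le_trans (le 1%:nng (- v)) _.
  by rewrite /= scale1r addNr mul1r sublinear0// sub0r.
Qed.

Lemma odd_sublinear_scalar s : sublinear s -> (forall v, s (- v) = - s v) ->
  scalar (s : X -> R^o).
Proof.
move=> ss sN.
have sD y z : s (y + z) = s y + s z.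
  apply/eqP; rewrite eq_le ss.2/=.
  by have := ss.2 (y + z) (- z); rewrite addrK sN; lra.
move=> a y z; rewrite sD; congr (_ + _).
have [a0|a0] := leP 0 a; first by rewrite sublinearZ.
rewrite -[a]opprK scaleNr sN sublinearZ ?mulNr// oppr_ge0; exact: ltW.
Qed.

(** Zorn applies because a chain of sublinear functionals below [q] is bounded
    below by [- q (- y)], so that its pointwise infimum is again sublinear. *)
Lemma minimal_sublinear q : sublinear q -> exists s, [/\ sublinear s,
  forall y, s y <= q y &
  forall s', sublinear s' -> (forall y, s' y <= s y) -> s' = s].
Proof.
move=> sq.
pose T := {s | sublinear s /\ forall y, s y <= q y}.
pose below (s t : T) := `[< forall y, sval t y <= sval s y >].
have [||s t /asboolP st /asboolP ts|A Atot|s smin] := @Zorn T below.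
- by move=> s; apply/asboolP.
- move=> r s t /asboolP rs /asboolP st; apply/asboolP => y.
  exact: le_trans (st y) (rs y).
- case: s t st ts => s Ps [t Pt] /= st ts; apply: eq_exist.
  by apply/funext => y; apply/eqP; rewrite eq_le ts st.
- have [->|/set0P [a Aa]] := eqVneq A set0.
    by exists (exist _ q (conj sq (fun=> lexx _))).
  pose S (i : {s | A s}) := sval (sval i).
  have := @inf_family_sublinear _ (exist _ a Aa) S (fun y => - q (- y)).
  case=> [i y|i r y r0|i j y z|sl le].
  + case: i => -[s [ss sq'] As]; rewrite /S/=.
    have := sublinearN y ss; have := sq' (- y); lra.
  + by exists i; case: i => -[s [ss sq'] As]; exact: ss.1.
  + have [/asboolP ij|/asboolP ji] := Atot _ _ (svalP i) (svalP j).
    * exists j; rewrite (le_trans ((svalP (sval j)).1.2 y z))// lerD2r.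
      exact: ij.
    * exists i; rewrite (le_trans ((svalP (sval i)).1.2 y z))// lerD2l.
      exact: ji.
  + have leq y : inf (range (S^~ y)) <= q y.
      by rewrite (le_trans (le (exist _ a Aa) y))// (svalP a).2.
    exists (exist _ (fun y => inf (range (S^~ y))) (conj sl leq)) => s As.
    apply/asboolP => y.
    exact: (le (exist _ s As)).
- exists (sval s); split; [exact: (svalP s).1|exact: (svalP s).2|].
  move=> s' ss' s's.
  have s'q y : s' y <= q y by rewrite (le_trans (s's y))// (svalP s).2.
  by have <- := smin (exist _ s' (conj ss' s'q)) ltac:(exact/asboolP).
Qed.

(** Hahn-Banach in the form of a supporting functional: a minimal sublinear
    functional is odd, as it equals all its slides, hence linear. Starting
    from a slide of [q] along [v] forces the value [q v] at [v]. *)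
Lemma supporting_functional q v : sublinear q -> exists psi : X -> R^o,
  [/\ scalar psi, forall y, psi y <= q y & psi v = q v].
Proof.
move=> sq; have [sqv qvq qvN] := slideP v sq.
have [s [ss sqv' smin]] := minimal_sublinear sqv.
have sN y : s (- y) = - s y.
  have [sl le leN] := slideP y ss; rewrite (smin _ sl le) in leN.
  by apply/eqP; rewrite eq_le leN lerNl sublinearN.
exists s; split; first exact: odd_sublinear_scalar.
- by move=> y; exact: le_trans (sqv' y) (qvq y).
- apply/eqP; rewrite eq_le (le_trans (sqv' v) (qvq v))/=.
  by have := sqv' (- v); rewrite sN; lra.
Qed.

End sublinear_functionals.

(** * The dual norm *)

Section dual_norm.
Context (R : realType) (X : lmodType R) (p : asym_norm X).
Implicit Types (psi : X -> R^o) (t : R) (z : X).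

Lemma asym_norm_sublinear : sublinear p.
Proof.
by split=> [r y r0|]; [rewrite asym_normZ|exact: asym_normD].
Qed.

Lemma scalar_funZ psi : scalar psi -> forall a z, psi (a *: z) = a * psi z.
Proof.
move=> lpsi; have psi0 : psi 0 = 0.
  have /eqP := lpsi (-1) 0 0.
  by rewrite scaleN1r oppr0 addr0 mulN1r addNr => /eqP.
by move=> a z; rewrite -[a *: z]addr0 lpsi psi0 addr0.
Qed.

Lemma scalar_funB psi : scalar psi -> forall y z, psi (y - z) = psi y - psi z.
Proof. by move=> lpsi y z; rewrite addrC -scaleN1r lpsi mulN1r addrC. Qed.

Lemma scalar_scale psi t : scalar psi -> scalar (t *: psi).
Proof.
move=> lpsi a y z; change (t * psi (a *: y + z) = a * (t * psi y) + t * psi z).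
by rewrite lpsi mulrDr mulrCA.
Qed.

Lemma le_dual_norm psi t : scalar psi -> (dual_norm p psi <= t%:E)%E ->
  forall z, psi z <= t * p z.
Proof.
move=> lpsi Nt z.
have pt y : p y < 1 -> psi y <= t.
  move=> y1; rewrite -lee_fin (le_trans _ Nt)//; apply: ereal_sup_ubound.
  by exists y => //; rewrite /asym_ball/= subr0.
have t0 : 0 <= t.
  have := pt 0; rewrite ((asym_norm_eq0 p 0).1 erefl).1 => /(_ ltr01).
  by have := scalar_funZ lpsi 0 0; rewrite scale0r mul0r => ->.
(* [psi z <= t * s] for every [s > p z], by scaling [z] into the unit ball *)
have lt s : p z < s -> psi z <= t * s.
  move=> zs; have s0 : 0 < s by rewrite (le_lt_trans _ zs)// asym_norm_ge0.
  have s'0 : 0 <= s^-1 by rewrite invr_ge0 ltW.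
  have := pt (s^-1 *: z); rewrite asym_normZ// ltr_pdivrMl//.
  by rewrite mulr1 scalar_funZ// ler_pdivrMl// mulrC => /(_ zs).
apply/ler_addgt0Pr => e e0.
have t1 : 0 < t + 1 by rewrite ltr_wpDl.
rewrite (le_trans (lt (p z + e / (t + 1)) _)) ?ltrDl ?divr_gt0//.
rewrite mulrDr lerD2l mulrCA ler_piMr ?(ltW e0)//.
by rewrite ler_pdivrMr// mul1r lerDl.
Qed.

Lemma dual_norm_le psi t : 0 <= t -> (forall z, psi z <= t * p z) ->
  (dual_norm p psi <= t%:E)%E.
Proof.
move=> t0 le; apply: ge_ereal_sup => _ [z + <-].
rewrite /asym_ball/= subr0 => z1; rewrite lee_fin (le_trans (le z))//.
by rewrite ler_piMr// ltW.
Qed.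

Lemma dual_norm_ge0 psi : scalar psi -> (0 <= dual_norm p psi)%E.
Proof.
move=> lpsi; apply: ereal_sup_ubound; exists 0.
  by rewrite /asym_ball/= subr0 ((asym_norm_eq0 p 0).1 erefl).1.
by have := scalar_funZ lpsi 0 0; rewrite scale0r mul0r => ->.
Qed.

Lemma dual_norm_of_attained psi t v : scalar psi -> 0 <= t ->
  (forall z, psi z <= t * p z) -> 0 < p v -> psi v = t * p v ->
  dual_norm p psi = t%:E.
Proof.
move=> lpsi t0 le pv psiv.
have Nt := dual_norm_le t0 le; have N0 := dual_norm_ge0 lpsi.
have /fineK NE : dual_norm p psi \is a fin_num.
  by rewrite ge0_fin_numE// (le_lt_trans Nt) ?ltry.
apply/eqP; rewrite eq_le Nt -NE lee_fin -(ler_pM2r pv) -psiv.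
by apply: le_dual_norm => //; rewrite NE.
Qed.

Lemma dual_coneZ psi t : 0 <= t -> dual_cone p psi ->
  dual_cone p (t *: psi).
Proof.
move=> t0 /dual_coneP[lpsi [C C0 psiC]];
  apply/dual_coneP; split; first exact: scalar_scale.
exists (t * C) => [|z]; first exact: mulr_ge0.
change (t * psi z <= t * C * p z).
by rewrite -mulrA ler_wpM2l.
Qed.

End dual_norm.

(** * Well-posed minimisation *)

Section well_posed.
Context (R : realType).

Lemma cvge0_squeeze (T : Type) (F : set_system T) {FF : Filter F}
    (h : T -> \bar R) :
  (forall e, 0 < e -> \forall t \near F, (0 <= h t <= e%:E)%E) ->
  h @ F --> 0%E.
Proof.
move=> he; apply/fine_cvgP; split.
  near=> t; have /andP[h0 h1] : (0 <= h t <= 1%:E)%E by near: t; exact: he.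
  by rewrite ge0_fin_numE// (le_lt_trans h1) ?ltry.
apply/cvgrPdist_le => e e0; near=> t.
have /andP[h0 h1] : (0 <= h t <= e%:E)%E by near: t; exact: he.
rewrite /= sub0r normrN ger0_norm ?fine_ge0// -lee_fin fineK//.
by rewrite ge0_fin_numE// (le_lt_trans h1) ?ltry.
Unshelve. all: by end_near. Qed.

(** The filter-free form of the convergence of all minimising sequences: [k]
    is small wherever [g] is close enough to [m]. *)
Definition well_posed (X : Type) (k : X -> R) (g : X -> \bar R) (m : R) :=
  forall e, 0 < e -> exists2 d, 0 < d &
    forall y, (g y < (m + d)%:E)%E -> k y < e.

Lemma well_posed_cvg (X : Type) (k : X -> R) g m (y : nat -> X) :
    (forall z, 0 <= k z) -> well_posed k g m ->
  g (y n) @[n --> \oo] --> m%:E -> k (y n) @[n --> \oo] --> (0 : R).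
Proof.
move=> k0 wp gy; apply/cvgrPdist_lt => e /wp[d d0 gd].
have : \forall n \near \oo, (g (y n) < (m + d)%:E)%E.
  apply: (gy [set z | (z < (m + d)%:E)%E]).
  apply: (@nbhs_open_ereal_lt R m (fun r => r + d)).
  by rewrite ltrDl.
by apply: filterS => n /gd; rewrite sub0r normrN ger0_norm.
Qed.

(** If [k] were not small near the infimum, picking one bad point at each level
    [m + 1 / n.+1] would produce a minimising sequence along which [k] stays
    away from [0]. *)
Lemma cvg_well_posed (X : Type) (k : X -> R) g m :
    (forall z, (m%:E <= g z)%E) ->
    (forall y : nat -> X, g (y n) @[n --> \oo] --> m%:E ->
       k (y n) @[n --> \oo] --> (0 : R)) ->
  well_posed k g m.
Proof.
move=> mg gk e e0; apply: contrapT => nd.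
have /choice[y yP] : forall n : nat, exists y,
    (g y < (m + n.+1%:R^-1)%:E)%E /\ e <= k y.
  move=> n; apply: contrapT => ny; apply: nd; exists n.+1%:R^-1 => // y gy.
  by rewrite ltNge; apply/negP => ek; apply: ny; exists y.
have : k (y n) @[n --> \oo] --> (0 : R).
  apply: gk; apply: (@squeeze_cvge _ _ _ _ (fun=> m%:E) _
    (fun n : nat => (m + n.+1%:R^-1)%:E)).
  - by near=> n; rewrite mg ltW//; exact: (yP n).1.
  - exact: cvg_cst.
  - apply: cvg_EFin; first by near=> n.
    rewrite -[X in _ --> X]addr0; apply: cvgD; first exact: cvg_cst.
    exact: cvg_harmonic.
move=> /cvgrPdist_lt/(_ e e0)/filter_ex[n].
by rewrite sub0r normrN ltNge (le_trans (yP n).2)// ler_norm.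
Unshelve. all: by end_near. Qed.

End well_posed.

(** * Conjugates *)

Section conjugate.
Context (R : realType) (X : lmodType R) (p : asym_norm X).
Local Notation q := (conj_norm p).
Implicit Types (f : X -> \bar R) (phi psi : X -> R^o) (x y : X) (m e t : R).

Lemma conv_conj_ereal_inf f phi :
  conv_conj f phi = (- ereal_inf (range (fun y => f y - (phi y)%:E)))%E.
Proof.
rewrite -ereal_supN /conv_conj image_comp; congr ereal_sup.
by apply: eq_imagel => y _; rewrite /= fin_num_oppeD//= opprK addeC.
Qed.

Lemma conv_conj_eq_min f phi m x :
    (f x - (phi x)%:E = ereal_inf (range (fun y => f y - (phi y)%:E)))%E ->
    (f x - (phi x)%:E = m%:E)%E ->
  conv_conj f phi = (- m)%:E.
Proof. by rewrite conv_conj_ereal_inf => <- ->. Qed.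

(** The dual cone detects [p (x - y)]: a functional of dual norm [t] can be
    chosen to have increment [t * p (x - y)] from [x] to [y]. If [y] nearly
    minimises [f - phi], this increment survives in the conjugate at
    [phi + psi] and must be swallowed by the Frechet remainder. *)
Lemma frechet_well_posed f phi x m :
    (forall y, f y != -oo%E) ->
    conv_conj f phi = (- m)%:E ->
    is_right_frechet_derivative (dual_cone q) (dual_norm q)
      (conv_conj f) phi (fun psi => psi x) ->
  well_posed (fun y => p (x - y)) (fun y => f y - (phi y)%:E)%E m.
Proof.
move=> fNy Fphi [_ Fr] e e0.
have e20 : 0 < e / 2 by rewrite divr_gt0.
have : \forall t \near (0 : R)^'+, 0 < t /\ (Defs.ereal_sup0
    [set ((t^-1)%R%:E *
         `|conv_conj f (phi + psi)%R - conv_conj f phi - (psi x)%:E|)%E |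
      psi in [set psi | dual_cone q psi /\ dual_norm q psi = t%:E]]
    < (e / 2)%:E)%E.
  apply: filterI; first exact: nbhs_right_gt.
  apply: (Fr [set z | (z < (e / 2)%:E)%E]).
  exact: (@nbhs_open_ereal_lt R 0 (fun=> e / 2)).
move=> /filter_ex[t [t0]]; rewrite /Defs.ereal_sup0.
set A := (X in X == set0) => At.
exists (e / 2 * t) => [|y gy]; first exact: mulr_gt0.
have := asym_norm_ge0 p (x - y); rewrite le_eqVlt => /orP[/eqP<-//|pxy].
have qyx : q (y - x) = p (x - y) by rewrite /= opprB.
have [psi [lpsi psiq psiyx]] := supporting_functional (y - x)
  (asym_norm_sublinear q).
rewrite qyx in psiyx.
have Ypsi : dual_cone q psi.
  by apply/dual_coneP; split=> //; exists 1 => // z; rewrite mul1r.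
have Ytpsi := dual_coneZ (ltW t0) Ypsi.
have [ltpsi _] := (dual_coneP q _).1 Ytpsi.
have Ntpsi : dual_norm q (t *: psi) = t%:E.
  apply: (@dual_norm_of_attained _ _ _ _ _ (y - x)) => //; [exact: ltW| | |].
  - by move=> z; change (t * psi z <= t * q z); rewrite ler_wpM2l// ltW.
  - by rewrite qyx.
  - by rewrite qyx -psiyx.
have : A ((t^-1)%R%:E * `|conv_conj f (phi + t *: psi)%R - conv_conj f phi
    - ((t *: psi) x)%:E|)%E by exists (t *: psi).
move=> AD; move: At; case: ifPn => [/eqP A0|_ At]; first by rewrite A0 in AD.
have := le_lt_trans (ereal_sup_ubound AD) At.
rewrite Fphi lte_pdivrMl//.
have : ((phi y + t * psi y)%:E - f y <= conv_conj f (phi + t *: psi)%R)%E.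
  by apply: ereal_sup_ubound; exists y.
change ((t *: psi) x) with (t * psi x).
rewrite (scalar_funB lpsi) in psiyx.
move: gy (fNy y); case: (f y) => [r| |]//.
rewrite -!EFinB lte_fin => gy _.
case: (conv_conj f _) => [u| |]//; rewrite -?EFinB/= ?lee_fin ?lte_fin => ru.
  rewrite ltr_norml => /andP[_ ub].
  rewrite -(ltr_pM2l t0) -psiyx; lra.
Qed.

(** Well-posedness gives a gap between [m] and the values of [f - phi] on the
    sphere of radius [e] around [x]. Convexity on the segment from [x] to a
    point outside the ball propagates it: [f - phi - m] is at least the gap
    divided by [e], times the distance to [x]. *)
Lemma convex_well_posed_growth f phi x m e :
    convex_efun f -> scalar phi ->
    (f x - (phi x)%:E = m%:E)%E ->
    (forall y, (m%:E <= f y - (phi y)%:E)%E) ->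
    well_posed (fun y => p (x - y)) (fun y => f y - (phi y)%:E)%E m ->
    0 < e ->
  exists2 d, 0 < d & forall t y, 0 <= t -> t <= d ->
    ((m + t * (p (x - y) - e))%:E <= f y - (phi y)%:E)%E.
Proof.
move=> cf lphi gx mg wp e0; have [d d0 gd] := wp e e0.
exists (d / e) => [|t y t0 td]; first exact: divr_gt0.
have [Qe|eQ] := leP (p (x - y)) e.
  apply: le_trans (mg y); rewrite lee_fin gerDl mulr_ge0_le0// subr_le0.
  exact: Qe.
have Q0 : 0 < p (x - y) by exact: lt_trans eQ.
have l0 : 0 <= e / p (x - y) by rewrite divr_ge0// ltW.
have l1 : e / p (x - y) <= 1 by rewrite ler_pdivrMr// mul1r ltW.
move: gx (mg y); case fxE : (f x) => [a| |]//; case fyE : (f y) => [r| |]//;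
  last by move=> *; rewrite leey.
rewrite -!EFinB !lee_fin => -[gx] mr.
have := cf (y, r : R^o) (x, a : R^o) (Itv01 l0 l1).
rewrite !inE /epigraph/= fxE fyE => /(_ (lexx _) (lexx _)).
set z := (X in f X); set l := e / p (x - y) in l0 l1 z *.
have zE : z = x + l *: (y - x).
  change (l *: y + (1 - l) *: x = x + l *: (y - x)).
  by rewrite scalerBr scalerBl scale1r addrCA.
have pxz : p (x - z) = e.
  rewrite zE opprD addrA subrr add0r -scalerN opprB asym_normZ//.
  by rewrite /l divfK// gt_eqF.
have phiz : phi z = phi x + l * (phi y - phi x).
  by rewrite zE addrC lphi (scalar_funB lphi) addrC.
have : ((m + d)%:E <= f z - (phi z)%:E)%E.
  by rewrite leNgt; apply/negP => /gd; rewrite pxz ltxx.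
case: (f z) => [c| |]//; rewrite -EFinB !lee_fin => mdc cle.
have lr : d <= l * (r - phi y - m).
  have {}cle : c <= l * r + (1 - l) * a := cle.
  rewrite phiz in mdc; rewrite -gx in mdc *; lra.
have drm : d / e * p (x - y) <= r - phi y - m.
  rewrite mulrAC ler_pdivrMr// [leRHS]mulrC.
  by move: lr; rewrite /l mulrAC ler_pdivlMr.
have := ler_wpM2r (ltW Q0) td.
have := mulr_ge0 t0 (ltW e0); lra.
Qed.

Lemma conj_remainder f phi x m e t psi :
    scalar psi -> (forall z, psi z <= t * q z) ->
    conv_conj f phi = (- m)%:E -> (f x - (phi x)%:E = m%:E)%E ->
    (forall y, ((m + t * (p (x - y) - e))%:E <= f y - (phi y)%:E)%E) ->
  (0 <= conv_conj f (phi + psi)%R - conv_conj f phi - (psi x)%:E <= (t * e)%:E)%E.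
Proof.
move=> lpsi psiq Fphi gx growth; rewrite Fphi.
have ub : (conv_conj f (phi + psi)%R <= (- m + psi x + t * e)%:E)%E.
  apply: ge_ereal_sup => _ [y _ <-].
  change ((phi + psi) y) with (phi y + psi y).
  have := psiq (y - x); rewrite /= opprB (scalar_funB lpsi) => psiyx.
  have := growth y; case: (f y) => [r| |]//=; rewrite ?lee_fin ?leNye ?leeNy_eq//; lra.
have : ((phi x + psi x)%:E - f x <= conv_conj f (phi + psi)%R)%E.
  by apply: ereal_sup_ubound; exists x.
move: gx ub; case: (f x) => [a| |]//; case: (conv_conj f _) => [u| |]//.
rewrite -!EFinB => -[gx]; rewrite !lee_fin => h1 h2; apply/andP; split; lra.
Qed.

(** All functionals in a bounded part of the dual cone obey the same remainder
    bound, which gives the Frechet limit and, along a single direction, the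
    Gateaux limit. *)
Lemma growth_frechet f phi x m :
    conv_conj f phi = (- m)%:E -> (f x - (phi x)%:E = m%:E)%E ->
    (forall e, 0 < e -> exists2 d, 0 < d & forall t y, 0 <= t -> t <= d ->
      ((m + t * (p (x - y) - e))%:E <= f y - (phi y)%:E)%E) ->
  is_right_frechet_derivative (dual_cone q) (dual_norm q)
    (conv_conj f) phi (fun psi => psi x).
Proof.
move=> Fphi gx growth; split; [split|].
- by rewrite Fphi.
- move=> u _ A [e /= e0 Ae].
  have P0 : 0 < p x + p (- x) + 1.
    by have := asym_norm_ge0 p x; have := asym_norm_ge0 p (- x); lra.
  exists (e / (p x + p (- x) + 1)) => /=; first exact: divr_gt0.
  move=> _ [v [/dual_coneP[lv _] /ltW/(le_dual_norm lv) vq] <-]; apply: Ae => /=.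
  change ((u + v) x) with (u x + v x).
  rewrite opprD addrA subrr add0r normrN.
  set r := e / _ in vq.
  have r0 : 0 < r by exact: divr_gt0.
  have := vq x; have := vq (- x); rewrite /= opprK -scaleN1r (scalar_funZ lv) scaleN1r.
  have rE : r * (p x + p (- x) + 1) = e by rewrite /r divfK// gt_eqF.
  have := mulr_ge0 (ltW r0) (asym_norm_ge0 p x).
  have := mulr_ge0 (ltW r0) (asym_norm_ge0 p (- x)).
  by move=> *; rewrite ltr_norml; apply/andP; split; lra.
- by move=> a b u v _ _ _ _.
- move=> v /dual_coneP[lv [C C0 vC]].
  apply: cvge0_squeeze => e e0.
  have C1 : 0 < C + 1 by rewrite ltr_wpDl.
  have [d d0 gd] := growth (e / (C + 1)) (divr_gt0 e0 C1).
  near=> t.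
  have t0 : 0 < t by near: t; exact: nbhs_right_gt.
  have td : t * (C + 1) <= d.
    by rewrite -ler_pdivlMr//; near: t; apply: nbhs_right_le; exact: divr_gt0.
  have tC0 : 0 <= t * (C + 1) by rewrite mulr_ge0 ?ltW.
  have := @conj_remainder f phi x m (e / (C + 1)) (t * (C + 1)) (t *: v)
    (scalar_scale t lv) _
    Fphi gx (fun y => gd _ y tC0 td).
  case/(_ _)/andP => [z|lb ub].
    change (t * v z <= t * (C + 1) * q z).
    rewrite -mulrA ler_wpM2l ?(ltW t0)// (le_trans (vC z))//.
    by rewrite ler_wpM2r ?asym_norm_ge0// lerDl.
  apply/andP; split.
    by rewrite mule_ge0// lee_fin invr_ge0 ltW.
  rewrite lee_pdivrMl// (le_trans ub)// -EFinM lee_fin.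
  by rewrite -mulrA [(C + 1) * _]mulrC divfK ?gt_eqF.
- apply: cvge0_squeeze => e e0; have [d d0 gd] := growth e e0.
  near=> t.
  have t0 : 0 < t by near: t; exact: nbhs_right_gt.
  have td : t <= d by near: t; exact: nbhs_right_le.
  rewrite /Defs.ereal_sup0; case: ifPn => [_|/set0P[b Ab]].
    by rewrite lexx lee_fin ltW.
  have Ale : forall c, [set ((t^-1)%R%:E *
      `|conv_conj f (phi + psi)%R - conv_conj f phi - (psi x)%:E|)%E |
      psi in [set psi | dual_cone q psi /\ dual_norm q psi = t%:E]] c ->
      (0 <= c <= e%:E)%E.
    move=> _ [psi [/dual_coneP[lpsi _] Npsi] <-].
    have psiq : forall z, psi z <= t * q z.
      by apply: le_dual_norm => //; rewrite Npsi.
    have /andP[lb ub] := conj_remainder lpsi psiq Fphi gx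
      (fun y => gd _ y (ltW t0) td).
    rewrite gee0_abs//; apply/andP; split.
      by rewrite mule_ge0// lee_fin invr_ge0 ltW.
    by rewrite lee_pdivrMl.
  apply/andP; split.
    by apply: le_trans (ereal_sup_ubound Ab); have /andP[] := Ale _ Ab.
  by apply: ge_ereal_sup => c /Ale/andP[].
Unshelve. all: by end_near. Qed.

End conjugate.

(** * Minimisers and semicontinuity *)

Section minimisers.
Context (R : realType) (X : lmodType R) (p : asym_norm X).
Local Notation q := (conj_norm p).
Implicit Types (f : X -> \bar R) (phi : X -> R^o) (x : X) (m : R).

(** [- phi] is only upper semicontinuous for [p], so the limit inferior along
    [y] cannot be taken for [f - phi] at once: [f] passes to the limit because
    of the convergence in [p], and [phi] because of the convergence in the
    conjugate norm. *)
Lemma lsc_lim_le f phi x m (y : nat -> X) :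
    lsc_at p f x -> dual_cone q phi ->
    (f (y n) - (phi (y n))%:E)%E @[n --> \oo] --> m%:E ->
    p (y n - x) @[n --> \oo] --> (0 : R) ->
    p (x - y n) @[n --> \oo] --> (0 : R) ->
  (f x - (phi x)%:E <= m%:E)%E.
Proof.
move=> flsc /dual_coneP[lphi [C C0 phiC]] gy pyx pxy.
rewrite leNgt; apply/negP => mg.
have [c mc cf] : exists2 c, m < c & ((phi x + c)%:E < f x)%E.
  move: mg; case: (f x) => [r| |]//; last by exists (m + 1); rewrite ?ltrDl ?ltry.
  rewrite -EFinB lte_fin => mr; exists ((m + (r - phi x)) / 2); first lra.
  by rewrite lte_fin; lra.
have h0 : 0 < (c - m) / 2 by rewrite divr_gt0// subr_gt0.
have C1 : 0 < C + 1 by rewrite ltr_wpDl.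
have [r /= r0 fr] := flsc _ cf.
have ev1 : \forall n \near \oo, p (y n - x) < r.
  move/cvgrPdist_lt : pyx => /(_ r r0); apply: filterS => n.
  by rewrite sub0r normrN ger0_norm ?asym_norm_ge0.
have ev2 : \forall n \near \oo, p (x - y n) < (c - m) / 2 / (C + 1).
  move/cvgrPdist_lt : pxy => /(_ _ (divr_gt0 h0 C1)); apply: filterS => n.
  by rewrite sub0r normrN ger0_norm ?asym_norm_ge0.
have ev3 : \forall n \near \oo,
    (f (y n) - (phi (y n))%:E < (m + (c - m) / 2)%:E)%E.
  apply: (gy [set z | (z < (m + (c - m) / 2)%:E)%E]).
  apply: (@nbhs_open_ereal_lt R m (fun r => r + (c - m) / 2)).
  by rewrite ltrDl.
have [n [+ [pxyn]]] := filter_ex (filterI ev1 (filterI ev2 ev3)).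
move=> /fr /=; case: (f (y n)) => [s| |]//.
rewrite -EFinB !lte_fin => fs gs.
have := phiC (y n - x); rewrite /= opprB (scalar_funB lphi) => phiyx.
move: pxyn; rewrite ltr_pdivlMr// mulrC mulrDl mul1r.
have := asym_norm_ge0 p (x - y n); lra.
Qed.

(** A minimiser [x] of [f - phi] makes [f] lie above the translate of [phi]
    through [(x, f x)], and elements of the dual cone of the conjugate are
    lower semicontinuous for [p]. *)
Lemma min_lsc f phi x m : dual_cone q phi ->
    (f x - (phi x)%:E = m%:E)%E ->
    (forall y, (m%:E <= f y - (phi y)%:E)%E) ->
  lsc_at p f x.
Proof.
move=> /dual_coneP[lphi [C C0 phiC]] gx mg a.
have C1 : 0 < C + 1 by rewrite ltr_wpDl.
move: gx; case: (f x) => [b| |]//; rewrite -EFinB => -[gx]; rewrite lte_fin => ab.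
exists ((b - a) / (C + 1)) => /=; first by rewrite divr_gt0// subr_gt0.
move=> y; rewrite /asym_ball/= ltr_pdivlMr// => pyx.
have := phiC (x - y); rewrite /= opprB (scalar_funB lphi) => phixy.
have := mg y; case: (f y) => [r| |]//; last by rewrite ltry.
rewrite -EFinB lee_fin lte_fin => mr.
have := asym_norm_ge0 p (y - x); rewrite mulrC mulrDl mul1r in pyx; lra.
Qed.

(** The Fenchel-Young inequality bounds the biconjugate by [f x], and at a
    minimiser of [f - phi] the supremum is attained at [phi]. *)
Lemma min_biconj f phi x m : dual_cone q phi ->
    (f x - (phi x)%:E = m%:E)%E ->
    conv_conj f phi = (- m)%:E ->
  conv_biconj p f x = f x.
Proof.
move=> Yphi gx Fphi; apply/eqP; rewrite eq_le; apply/andP; split.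
- apply: ge_ereal_sup => _ [psi _ <-].
  have : ((psi x)%:E - f x <= conv_conj f psi)%E.
    by apply: ereal_sup_ubound; exists x.
  move: gx; case: (f x) => [b| |]// _.
  case: (conv_conj f psi) => [u| |]//; last by rewrite leNye.
  rewrite -!EFinB !lee_fin; lra.
- have : ((phi x)%:E - conv_conj f phi <= conv_biconj p f x)%E.
    by apply: ereal_sup_ubound; exists phi.
  move=> le; apply: (le_trans _ le); rewrite Fphi; move: gx; case: (f x) => [b| |]//.
  rewrite -!EFinB => -[gx]; rewrite lee_fin; lra.
Qed.

End minimisers.

Theorem theorem3p1 (R : realType) (X : lmodType R) (p : asym_norm X)
    (f : X -> \bar R) (f_proper : proper_fun f) (x : X)
    (phi : X -> R^o) (phi_dual : dual_cone (conj_norm p) phi) :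
  let g : X -> \bar R := fun y => (f y - (phi y)%:E)%E in
  let stmt_i :=
    [/\ lsc_at p f x,
        is_right_frechet_derivative
          (dual_cone (conj_norm p)) (dual_norm (conj_norm p))
          (conv_conj f) phi (fun psi => psi x)
      & exists y : nat -> X,
          g (y n) @[n --> \oo] --> ereal_inf (range g) /\
          p (y n - x) @[n --> \oo] --> (0 : R)] in
  let stmt_ii :=
    g x = ereal_inf (range g) /\
    forall y : nat -> X,
      g (y n) @[n --> \oo] --> g x ->
      p (x - y n) @[n --> \oo] --> (0 : R) in
  let stmt_iii := f x \is a fin_num /\ conv_biconj p f x = f x in
  [/\ stmt_i -> stmt_ii,
      stmt_ii -> stmt_iii
    & convex_efun f -> (stmt_i <-> stmt_ii)].
Proof.
move=> g stmt_i stmt_ii stmt_iii.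
have [fNy [x0 fx0]] := f_proper.
have Fphi : conv_conj f phi = (- ereal_inf (range g))%E.
  exact: conv_conj_ereal_inf.
have inf_le y : (ereal_inf (range g) <= g y)%E.
  by apply: ereal_inf_lbound; exists y.
(* at a minimum of [g] the value is finite, since [f] is proper *)
have minE : g x = ereal_inf (range g) -> exists m, g x = m%:E.
  move=> gx; have := inf_le x0; rewrite -gx /g.
  move: (fNy x) (fNy x0) fx0; case: (f x) => [b| |]//; last by case: (f x0).
  by move=> *; exists (b - phi x).
have i_ii : stmt_i -> stmt_ii.
  move=> [flsc Fr [y [gy pyx]]].
  have [m mE] : exists m, ereal_inf (range g) = m%:E.
    have [[+ _ _ _] _] := Fr; rewrite Fphi fin_numN => /fineK <-.
    by exists (fine (ereal_inf (range g))).
  have Fm : conv_conj f phi = (- m)%:E by rewrite Fphi mE.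
  have wp := frechet_well_posed fNy Fm Fr.
  have cvg (z : nat -> X) : g (z n) @[n --> \oo] --> m%:E ->
      p (x - z n) @[n --> \oo] --> (0 : R).
    by apply: well_posed_cvg wp => z'; exact: asym_norm_ge0.
  rewrite mE in gy.
  have gx : g x = ereal_inf (range g).
    apply/eqP; rewrite eq_le inf_le andbT mE.
    exact: lsc_lim_le flsc phi_dual gy pyx (cvg y gy).
  by split=> //; rewrite gx mE.
split; first exact: i_ii.
- move=> [gx _]; have [m gm] := minE gx; split.
    by move: gm; rewrite /g; case: (f x).
  exact: (min_biconj phi_dual gm (conv_conj_eq_min gx gm)).
- move=> cf; split; first exact: i_ii.
  move=> [gx cvg]; have [m gm] := minE gx.
  have Fm := conv_conj_eq_min gx gm.
  have mg y : (m%:E <= g y)%E by rewrite -gm gx.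
  have wp : well_posed (fun y => p (x - y)) g m.
    apply: cvg_well_posed mg _ => y gy; apply: cvg.
    by rewrite gm.
  have [lphi _] := (dual_coneP _ _).1 phi_dual.
  split; first exact: min_lsc phi_dual gm mg.
  + apply: (growth_frechet Fm gm) => e e0.
    exact: convex_well_posed_growth cf lphi gm mg wp e0.
  + exists (fun=> x); rewrite subrr -gx; split; first exact: cvg_cst.
    rewrite ((asym_norm_eq0 p 0).1 erefl).1; exact: cvg_cst.
Qed.
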